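(* Let $\pi$ be a Borel probability measure on $\mathcal{X}$ and $(\mathcal{P}_\gamma)_{\gamma\in\mathcal{Y}}$ a family of Borel Markov kernels on $\mathcal{X}$ as in the context. Assume there is a function $W:\mathcal{X}\to[1,\infty)$ such that $\log(W)$ is Lipschitz (with respect to $d$) and $\int_{\mathcal{X}}W\,d\pi=\infty$, and that for some $\alpha>1$ and some concave function $\phi:(0,\infty)\to(0,\infty)$, $$\int_{\mathcal{X}}W(y)^\alpha\,\mathcal{P}_\gamma(x,dy)-W(x)^\alpha\le\phi(W(x)^\alpha)$$ holds for all $(x,\gamma)\in\mathcal{X}\times\mathcal{Y}$. Then for $\beta\in(0,1)$ with $\alpha>1+\beta$, there is a constant $M_*>0$ and a subsequence $t_n\in\mathbb{Z}_+$ increasing to infinity such that for every $n$, $$\inf_{\mathcal{Q}\in\mathcal{S}(\mathcal{X},\mathcal{Y})}\mathcal{W}_{d\wedge1}\left(\mathcal{A}_{\mathcal{Q}}^{(t_n)}((\gamma_0,x_0),\cdot),\pi\right)\ge\frac{M_*}{\left(H^{-1}_{W(x_0)^\alpha,\phi}(t_n)\right)^{\frac{1+\beta}{\alpha-1-\beta}}}.$$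
   Context: $(\mathcal{X},d)$ is a Polish space with metric $d$ (state space) and $\mathcal{Y}$ is a Borel measurable space (tuning parameters), with Borel sigma-algebras $\mathcal{B}(\mathcal{X}),\mathcal{B}(\mathcal{Y})$. $\mathbb{Z}_+$ denotes the positive integers. $(\mathcal{P}_\gamma)_{\gamma\in\mathcal{Y}}$ is a family of Markov kernels $\mathcal{P}_\gamma:\mathcal{X}\times\mathcal{B}(\mathcal{X})\to[0,1]$ such that $(x,\gamma)\mapsto\mathcal{P}_\gamma(x,\cdot)$ is Borel measurable. Adaptive process: an adaptation plan $\mathcal{Q}$ is a sequence $(\mathcal{Q}_t)_{t\in\mathbb{Z}_+}$ of Borel probability kernels $\mathcal{Q}_t:(\mathcal{Y}\times\mathcal{X})^t\times\mathcal{B}(\mathcal{Y})\to[0,1]$; $\mathcal{S}(\mathcal{X},\mathcal{Y})$ is the set of all adaptation plans. Given $\mathcal{Q}$ and a fixed initialization $(\Gamma_0,X_0)=(\gamma_0,x_0)\in\mathcal{Y}\times\mathcal{X}$, the adaptive process $(\Gamma_t,X_t)_{t\ge0}$ is defined for $t\ge1$ by $\Gamma_t\mid(\Gamma_s,X_s)_{0\le s\le t-1}\sim\mathcal{Q}_t((\Gamma_s,X_s)_{0\le s\le t-1},\cdot)$ and then, conditionally on $\Gamma_t$ and the past, $X_t\sim\mathcal{P}_{\Gamma_t}(X_{t-1},\cdot)$. The marginal law of $X_t$ is denoted $\mathcal{A}_{\mathcal{Q}}^{(t)}((\gamma_0,x_0),\cdot)$. $\mathcal{W}_{d\wedge1}(\mu,\nu)=\inf_{\xi\in\mathcal{C}(\mu,\nu)}\int_{\mathcal{X}\times\mathcal{X}}[d(x,y)\wedge1]\,\xi(dx,dy)$,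 where $\mathcal{C}(\mu,\nu)$ is the set of couplings of $\mu$ and $\nu$ (Borel probability measures on $\mathcal{X}\times\mathcal{X}$ with marginals $\mu,\nu$) and $a\wedge b=\min(a,b)$. For concave $\phi:(0,\infty)\to(0,\infty)$ and $w_0\in[1,\infty)$, define $H_{w_0,\phi}(w)=\int_{w_0}^w\frac{dv}{\phi(v)}$ for $w\ge w_0$; this is a strictly increasing function from $[w_0,\infty)$ onto $[0,\infty)$ and $H^{-1}_{w_0,\phi}:[0,\infty)\to[w_0,\infty)$ denotes its inverse. *)

(* Defs.v *)
From HB Require Import structures.
From mathcomp Require Import all_boot all_order all_algebra.
From mathcomp Require Import all_classical all_reals all_analysis.
(* Not re-exported by [all_analysis]; it makes [\bar R] a measurable type. *)
From mathcomp Require Import measurable_realfun.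

Set Implicit Arguments.
Unset Strict Implicit.
Unset Printing Implicit Defensive.

Import Order.TTheory GRing.Theory Num.Theory.
Import numFieldNormedType.Exports.

Local Open Scope classical_set_scope.
Local Open Scope ring_scope.

HB.mixin Record isSeparable T & Topological T := {
  separable_space : exists2 D : set T, countable D & dense D
}.

(* [Complete] refers to the uniformity of [mdist], so this is a nonempty
   complete separable metric space with its metric. *)
#[short(type="polishMetricType")]
HB.structure Definition PolishMetric (R : realType) :=
  {T of CompletePseudoMetric R T & Metric R T & isSeparable T}.

Notation borel X := (g_sigma_algebraType (@open X)).

Section metric.
Context {R : realType} (X : metricType R).

Definition metric_lipschitz (f : X -> R) :=
  exists L : R, forall x y, `|f x - f y| <= L * mdist x y.

End metric.

Section wasserstein.
Context {R : realType} (X : polishMetricType R).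
Local Open Scope ereal_scope.

(* As [X] is second countable, the product sigma-algebra carried by
   [borel X * borel X] is the Borel sigma-algebra of the product space. *)
Definition coupling (mu nu : probability (borel X) R) :
    set (probability (borel X * borel X)%type R) :=
  [set xi | forall A : set (borel X), measurable A ->
     pushforward xi fst A = mu A /\ pushforward xi snd A = nu A].

Definition wasserstein_min1 (mu nu : probability (borel X) R) : \bar R :=
  ereal_inf [set \int[xi]_z (Num.min (mdist (z.1 : X) (z.2 : X)) 1)%:E
            | xi in coupling mu nu].

End wasserstein.

Section mixture.
Context d1 d2 (T : measurableType d1) (U : measurableType d2) (R : realType).
Variables (mu : probability T R) (k : R.-pker T ~> U).
Local Open Scope ereal_scope.

Definition mixture (A : set U) : \bar R := \int[mu]_x k x A.

Let mixture0 : mixture set0 = 0.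
Proof. by apply: integral0_eq => x _; rewrite measure0. Qed.

Let mixture_ge0 A : 0 <= mixture A.
Proof. exact: integral_ge0. Qed.

Let mixture_sigma_additive : semi_sigma_additive mixture.
Proof.
move=> F mF tF mUF; rewrite [X in _ --> X](_ : _ =
    \sum_(0 <= n <oo) mixture (F n)).
  by apply: is_cvg_ereal_nneg_natsum => n _; exact: mixture_ge0.
rewrite /mixture -integral_nneseries//.
- by apply: eq_integral => x _; exact: measure_semi_bigcup.
- by move=> n; exact: measurable_kernel.
Qed.

HB.instance Definition _ := isMeasure.Build _ _ _ mixture
  mixture0 mixture_ge0 mixture_sigma_additive.

Let mixture_setT : mixture [set: U] = 1.
Proof.
rewrite /mixture; under eq_integral do rewrite prob_kernel.
rewrite integral_cst// mul1e; exact: probability_setT.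
Qed.

HB.instance Definition _ := Measure_isProbability.Build _ _ _ mixture
  mixture_setT.

End mixture.

Section adaptive_process.
Context {R : realType} (X : polishMetricType R)
  {dY : measure_display} (Y : measurableType dY).
Local Open Scope ereal_scope.

(* The histories (Gamma_s, X_s), 0 <= s <= t, carry the product
   sigma-algebra. *)
Local Notation history t := (t.+1.-tuple (Y * borel X)%type).

(* The component of index [t] is the law of Gamma_(t+1) given the pairs of
   indices 0, ..., t, that is, Q_(t+1) for the indexing by positive integers. *)
Definition adaptation_plan : Type := forall t : nat, R.-pker history t ~> Y.

Definition last_state t (h : history t) : borel X := (tnth h ord_max).2.

Definition extend t (h : history t) (z : Y * borel X) : history t.+1 :=
  [tuple of rcons h z].

Lemma measurable_last_state t :
  measurable_fun [set: history t] (@last_state t).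
Proof.
exact: (measurableT_comp measurable_snd (@measurable_tnth _ _ _ ord_max)).
Qed.

HB.instance Definition _ t := isMeasurableFun.Build _ _ _ _
  (@last_state t) (@measurable_last_state t).

Lemma measurable_extend t :
  measurable_fun [set: history t * Y * borel X]
    (fun w => extend w.1.1 (w.1.2, w.2)).
Proof.
apply/measurable_fun_tnthP => i.
have [it|ti] := ltnP i t.+1.
- rewrite (_ : _ \o _ = fun w => tnth w.1.1 (Ordinal it)).
    apply: (measurableT_comp (@measurable_tnth _ _ _ (Ordinal it))).
    exact: (measurableT_comp measurable_fst measurable_fst).
  apply/funext => w /=.
  by rewrite !(tnth_nth (w.1.2, w.2)) /= nth_rcons size_tuple it.
- have -> : i = ord_max.
    by apply/val_inj/eqP; rewrite /= eqn_leq ti -ltnS ltn_ord.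
  rewrite (_ : _ \o _ = fun w => (w.1.2, w.2)).
    apply: measurable_fun_pair => //.
    exact: (measurableT_comp measurable_snd measurable_fst).
  apply/funext => w /=.
  by rewrite (tnth_nth (w.1.2, w.2)) /= nth_rcons size_tuple ltnn eqxx.
Qed.

Variable P : R.-pker (borel X * Y) ~> borel X.

Section step.
Variable t : nat.

Definition transition (hg : history t * Y) : {measure set (borel X) -> \bar R} :=
  P (last_state hg.1, hg.2).

Let measurable_transition U : measurable U ->
  measurable_fun [set: history t * Y] (transition ^~ U).
Proof.
move=> mU; rewrite /transition.
apply: (measurableT_comp (measurable_kernel P U mU)).
apply: measurable_fun_pair => //.
exact: (measurableT_comp (@measurable_last_state t) measurable_fst).
Qed.

HB.instance Definition _ := isKernel.Build _ _ _ _ _ transition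
  measurable_transition.

Let transition_setT hg : transition hg [set: borel X] = 1.
Proof. exact: prob_kernel. Qed.

HB.instance Definition _ := Kernel_isProbability.Build _ _ _ _ _
  transition transition_setT.

Variable Q : R.-pker history t ~> Y.

(* Law of the history up to time t+1 given the history h up to time t: draw
   Gamma_(t+1) = g from Q h, then X_(t+1) = x from P_g(X_t, .), and return
   [extend h (g, x)]. *)
Definition adaptive_step :
    history t -> {measure set (history t.+1) -> \bar R} :=
  (Q \; (transition \; kdirac (@measurable_extend t)))%E.

HB.instance Definition _ := Kernel.on adaptive_step.

Let adaptive_step_setT h : adaptive_step h [set: history t.+1] = 1.
Proof.
have step1 hg : kcomp transition (kdirac (@measurable_extend t)) hg setT = 1.
  rewrite /kcomp; under eq_integral do rewrite prob_kernel.
  by rewrite integral_cst// mul1e; exact: transition_setT.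
rewrite /adaptive_step /mkcomp /= [LHS](_ : _ = \int[Q h]__ 1).
  by rewrite integral_cst// mul1e; exact: prob_kernel.
by apply: eq_integral => g _; exact: step1.
Qed.

HB.instance Definition _ := Kernel_isProbability.Build _ _ _ _ _
  adaptive_step adaptive_step_setT.

End step.

Variables (Q : adaptation_plan) (init : Y * borel X).

Fixpoint adaptive_law (t : nat) : probability (history t) R :=
  match t with
  | 0 => \d_([tuple init] : history 0)
  | t.+1 => mixture (adaptive_law t) (adaptive_step (Q t))
  end.

Definition adaptive_marginal (t : nat) : probability (borel X) R :=
  distribution (adaptive_law t) (@last_state t).

End adaptive_process.

Section drift.
Context {R : realType}.

Definition concave_on (D : set R^o) (f : R^o -> R^o) :=
  convex_function D (fun x => - f x).

Definition drift_H (w0 : R) (phi : R -> R) (w : R) : R :=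
  \int[lebesgue_measure]_(v in `[w0, w]) (phi v)^-1.

(* The inverse of [drift_H w0 phi] on [w0, +oo[; outside the image of that
   interval, the partial inverse takes the default value [w0]. *)
Definition drift_Hinv (w0 : R) (phi : R -> R) : R -> R :=
  'pinv_(fun=> w0) `[w0, +oo[ (drift_H w0 phi).

End drift.

(* Main.v *)
Require Import Defs.
From HB Require Import structures.
From mathcomp Require Import all_boot all_order all_algebra.
From mathcomp Require Import all_classical all_reals all_analysis.
From mathcomp Require Import measurable_realfun ring lra.

Set Implicit Arguments.
Unset Strict Implicit.
Unset Printing Implicit Defensive.

Import Order.TTheory GRing.Theory Num.Theory.
Import numFieldNormedType.Exports.

Local Open Scope classical_set_scope.
Local Open Scope ring_scope.

(** Why the theorem is true.  Write [V] for [W `^ alpha] and [h t] for the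
    inverse of [drift_H (V x0) phi] at [t].

    An adaptation plan only chooses which of the kernels is used next, and the
    drift inequality holds for all of them, so the mean of [V] along the
    process satisfies [m (t+1) <= m t + phi (m t)] whatever the plan is
    (Jensen for the concave [phi]).  As [phi] is nondecreasing, this recursion
    is an Euler scheme that stays below the solution of [v' = phi v], which is
    [h]: the mean of [V] at time [t] is at most [h t]
    ([adaptive_moment_le]).  Concavity is used only through the existence of a
    supporting line with nonnegative coefficients ([concave_tangent]).

    The target has heavy tails: if [W] has infinite mean under [pi], then
    [pi {W >= r}] is at least [r `^ (- (1 + beta))] for arbitrarily large [r],
    since otherwise a dyadic sum would bound the mean ([heavy_tail]).  By
    contrast the process has [W >= r] with probability at most of order
    [r `^ (- alpha) * h t].  As [ln W] is Lipschitz, the two tails can be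
    compared by a test function that is Lipschitz for the distance capped at 1
    and goes from 0 to 1 while [W] goes from [r / e] to [r]; the difference of
    its means bounds the Wasserstein distance from below up to a constant
    ([wasserstein_min1_tail_ge]).

    It remains to take [t] as large as possible such that the contribution of
    the process is at most half of that of [pi], that is, with [h t] at most a
    constant times [r `^ (alpha - 1 - beta)].  Since [h (t + 1)] is at most a
    constant multiple of [h t] ([drift_H_dilation]), [h t] is then also at
    least a constant times this quantity, which turns [r `^ (- (1 + beta))]
    into a power of [h t].  Letting [r] go to infinity along the heavy tail
    gives arbitrarily large such times. *)

(** * Concave functions on the positive half-line *)

Section concave.
Context {R : realType} {phi : R -> R}.
Context (phi_gt0 : forall v : R, 0 < v -> 0 < phi v).
Context (phi_concave : concave_on `]0, +oo[ phi).

Lemma concave_chord (x m y : R) : 0 < x -> x < m -> m < y ->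
  (phi y - phi m) / (y - m) <= (phi m - phi x) / (m - x).
Proof.
move=> x0 xm my.
have xy : 0 < y - x by lra.
have t0 : 0 <= (y - m) / (y - x) by rewrite divr_ge0; lra.
have t1 : (y - m) / (y - x) <= 1 by rewrite ler_pdivrMr; lra.
have xD : (x : R^o) \in `]0, +oo[%classic by rewrite inE/= in_itv/= andbT.
have yD : (y : R^o) \in `]0, +oo[%classic.
  by rewrite inE/= in_itv/= andbT (lt_trans x0 (lt_trans xm my)).
have := phi_concave (Itv01 t0 t1) xD yD; rewrite !convRE /=.
rewrite /unstable.onem.
set z := conv _ _ _; have -> : z = m.
  by rewrite [z](convRE x y (Itv01 t0 t1))/= /unstable.onem; field; lra.
rewrite -(ler_pM2r xy).
have -> : ((y - m) / (y - x) * - phi x + (1 - (y - m) / (y - x)) * - phi y)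
    * (y - x) = - ((y - m) * phi x + (m - x) * phi y) by field; lra.
by rewrite ler_pdivrMr ?subr_gt0// mulrAC ler_pdivlMr ?subr_gt0//; nra.
Qed.

(** The slope is the supremum of the slopes of the chords to the right of [m],
    which are bounded by every slope to the left.  The coefficients are
    nonnegative because a line that vanishes somewhere on the positive
    half-line cannot stay above the positive function [phi].  Having both
    coefficients nonnegative makes the line harmless under integrals that may
    be infinite. *)
Lemma concave_tangent (m : R) : 0 < m ->
  exists a s : R, [/\ 0 <= a, 0 <= s, phi m = a + s * m &
    forall v, 0 < v -> phi v <= a + s * v].
Proof.
move=> m0.
pose S := [set (phi y - phi m) / (y - m) | y in `]m, +oo[].
have S_ub x : 0 < x -> x < m -> ubound S ((phi m - phi x) / (m - x)).
  move=> x0 xm _ [y/= + <-]; rewrite in_itv/= andbT => my.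
  exact: concave_chord.
have S_sup : has_sup S.
  split.
    exists ((phi (m + 1) - phi m) / (m + 1 - m)), (m + 1) => //=.
    by rewrite in_itv/= andbT ltrDl.
  by exists ((phi m - phi (m / 2)) / (m - m / 2)); apply: S_ub; lra.
set s := sup S.
have right y : m < y -> phi y <= phi m + s * (y - m).
  move=> my; rewrite -lerBlDl -ler_pdivrMr ?subr_gt0//.
  by apply: sup_upper_bound => //; exists y => //=; rewrite in_itv/= my.
have left x : 0 < x -> x < m -> phi x <= phi m + s * (x - m).
  move=> x0 xm; have : s <= (phi m - phi x) / (m - x).
    by apply: ge_sup; [case: S_sup|exact: S_ub].
  by rewrite ler_pdivlMr ?subr_gt0//; lra.
have bnd v : 0 < v -> phi v <= phi m + s * (v - m).
  by move=> v0; have [vm|mv|->] := ltgtP v m; [exact: left|exact: right|lra].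
have pm := phi_gt0 m0.
exists (phi m - s * m), s; split; last 2 first.
- by lra.
- by move=> v /bnd; lra.
- rewrite leNgt; apply/negP => neg.
  have s0 : 0 < s by rewrite ltNge; apply/negP; nra.
  (* the zero of the tangent line, where phi would be nonpositive *)
  pose v := m - phi m / s.
  have v0 : 0 < v by rewrite subr_gt0 ltr_pdivrMr// mulrC; lra.
  have := bnd _ v0; have := phi_gt0 v0.
  have -> : s * (v - m) = - phi m by rewrite /v; field; lra.
  lra.
- rewrite leNgt; apply/negP => s0.
  (* again the zero of the tangent line *)
  pose v := m - phi m / s.
  have v0 : 0 < v.
    have : phi m / s < 0 by rewrite pmulr_rlt0 ?invr_lt0.
    by rewrite /v; lra.
  have := bnd _ v0; have := phi_gt0 v0.
  have -> : s * (v - m) = - phi m by rewrite /v; field; lra.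
  lra.
Qed.

Lemma concave_nondecreasing (u v : R) : 0 < u -> u <= v -> phi u <= phi v.
Proof.
move=> u0 uv.
have [a [s [_ s0 -> tan]]] := concave_tangent (lt_le_trans u0 uv).
by rewrite (le_trans (tan _ u0))// lerD2l ler_wpM2l.
Qed.

(** The tangent line at [u] has a nonnegative value at 0, so it grows at most
    linearly from [u] on. *)
Lemma concave_sublinear (u v : R) : 0 < u -> u <= v ->
  phi v <= phi u / u * v.
Proof.
move=> u0 uv.
have [a [s [a0 s0 -> tan]]] := concave_tangent u0.
rewrite (le_trans (tan _ (lt_le_trans u0 uv)))//.
rewrite -(ler_pM2r u0).
have -> : (a + s * u) / u * v * u = (a + s * u) * v by field; lra.
nra.
Qed.

End concave.

(** * The comparison function of the drift *)

Section drift_comparison.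
Context {R : realType} {phi : R -> R}.
Context (phi_gt0 : forall v : R, 0 < v -> 0 < phi v).
Context (phi_concave : concave_on `]0, +oo[ phi).
Context {w0 : R} (w0_gt0 : 0 < w0).

Let phi_ndecr := concave_nondecreasing phi_gt0 phi_concave.
Local Notation H := (drift_H w0 phi).

Lemma integrable_inv_concave (w : R) :
  lebesgue_measure.-integrable `[w0, w] (EFin \o (fun v : R => (phi v)^-1)).
Proof.
apply: measurable_bounded_integrable => //.
- by rewrite /= lebesgue_measure_itv/=; case: ifP => // _; rewrite -EFinB ltry.
(* freezing phi below w0 makes its inverse nonincreasing on the whole line *)
- apply: (@eq_measurable_fun _ _ _ _ _
    (fun v : R => (phi (Num.max w0 v))^-1)) => [v|].
    by rewrite inE/= in_itv/= => /andP[w0v _]; rewrite max_r.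
  apply: nonincreasing_measurable => // u v uv.
  have max_gt0 x : 0 < Num.max w0 x by rewrite lt_max w0_gt0.
  rewrite lef_pV2 ?posrE ?phi_gt0//; apply: phi_ndecr => //.
  by rewrite ge_max !le_max lexx uv orbT.
- exists (phi w0)^-1; split; first exact: num_real.
  move=> x w0x v /=; rewrite in_itv/= => /andP[w0v _].
  have v0 := lt_le_trans w0_gt0 w0v.
  rewrite ger0_norm ?invr_ge0 ?ltW ?phi_gt0//.
  rewrite (le_lt_trans _ w0x)// lef_pV2 ?posrE ?phi_gt0//.
  exact: phi_ndecr.
Qed.

Lemma drift_HB (a b : R) : w0 <= a -> a <= b ->
  H b - H a = \int[lebesgue_measure]_(v in `]a, b]) (phi v)^-1.
Proof.
move=> w0a ab; rewrite /drift_H Rintegral_itvB//; exact: integrable_inv_concave.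
Qed.

Let itv_length (a b : R) : a <= b -> fine (lebesgue_measure `]a, b]) = b - a.
Proof.
move=> ab; rewrite lebesgue_measure_itv/= lte_fin.
by case: ltgtP ab => // -> _; rewrite subrr.
Qed.

Let integrable_Ioc (a b : R) : w0 <= a ->
  lebesgue_measure.-integrable `]a, b] (EFin \o (fun v : R => (phi v)^-1)).
Proof.
move=> w0a; apply: integrableS (integrable_inv_concave b) => //.
by apply: subset_itv; rewrite bnd_simp.
Qed.

Let integrable_cst_Ioc (a b r : R) :
  lebesgue_measure.-integrable `]a, b] (EFin \o (fun=> r)).
Proof.
apply: measurable_bounded_integrable => //=.
  by rewrite lebesgue_measure_itv/=; case: ifP => // _; rewrite -EFinB ltry.
exists `|r|; split; first exact: num_real.
by move=> x rx v _; exact: ltW.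
Qed.

Lemma drift_HB_ge (a b : R) : w0 <= a -> a <= b ->
  (b - a) / phi b <= H b - H a.
Proof.
move=> w0a ab; rewrite drift_HB// mulrC -(itv_length ab) -Rintegral_cst//.
apply: le_Rintegral => //; first exact: integrable_Ioc.
move=> v /=; rewrite in_itv/= => /andP[av vb].
have v0 : 0 < v by rewrite (lt_trans _ av)// (lt_le_trans w0_gt0).
rewrite lef_pV2 ?posrE ?phi_gt0//; last exact: lt_le_trans vb.
exact: phi_ndecr.
Qed.

Lemma drift_HB_le (a b : R) : w0 <= a -> a <= b ->
  H b - H a <= (b - a) / phi a.
Proof.
move=> w0a ab; rewrite drift_HB// mulrC -(itv_length ab) -Rintegral_cst//.
have a0 := lt_le_trans w0_gt0 w0a.
apply: le_Rintegral => //; first exact: integrable_Ioc.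
move=> v /=; rewrite in_itv/= => /andP[av vb].
rewrite lef_pV2 ?posrE ?phi_gt0//; last exact: lt_trans av.
by apply: phi_ndecr => //; exact: ltW.
Qed.

Lemma drift_H_w0 : H w0 = 0.
Proof. by rewrite /drift_H set_itv1 Rintegral_set1. Qed.

Lemma drift_H_lt (a b : R) : w0 <= a -> a < b -> H a < H b.
Proof.
move=> w0a ab; rewrite -subr_gt0; apply: lt_le_trans (drift_HB_ge w0a (ltW ab)).
rewrite divr_gt0 ?subr_gt0// phi_gt0// (lt_trans _ ab)//.
exact: lt_le_trans w0a.
Qed.

Lemma drift_H_le (a b : R) : w0 <= a -> a <= b -> H a <= H b.
Proof.
by move=> w0a; rewrite le_eqVlt => /predU1P[->//|/(drift_H_lt w0a)/ltW].
Qed.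

Lemma drift_H_le_inv (a b : R) : w0 <= b -> H a <= H b -> a <= b.
Proof.
move=> w0b; rewrite !leNgt; apply: contra; exact: drift_H_lt.
Qed.

(** One step of the Euler scheme for [v' = phi v] costs at most one unit of
    time, because the speed [phi] only increases along the exact solution. *)
Lemma drift_H_step (e : R) : w0 <= e -> H (e + phi e) <= H e + 1.
Proof.
move=> w0e; have pe := phi_gt0 (lt_le_trans w0_gt0 w0e).
have ee : e <= e + phi e by rewrite lerDl ltW.
by have := drift_HB_le w0e ee; rewrite addrAC subrr add0r divff ?gt_eqF//; lra.
Qed.

(** On [a, 2 * a] the speed is at most linear in [a], so doubling takes a time
    that is bounded below independently of [a]. *)
Lemma drift_H_double (a : R) : w0 <= a ->
  H a + w0 / (2 * phi w0) <= H (2 * a).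
Proof.
move=> w0a; have a0 := lt_le_trans w0_gt0 w0a; have p0 := phi_gt0 w0_gt0.
have a2a : a <= 2 * a by lra.
have p2a : 0 < phi (2 * a) by apply: phi_gt0; lra.
rewrite addrC -lerBrDr; apply: le_trans (drift_HB_ge w0a a2a).
rewrite ler_pdivlMr//.
have := concave_sublinear phi_gt0 phi_concave w0_gt0 (le_trans w0a a2a).
rewrite -(ler_pM2l (_ : 0 < w0 / (2 * phi w0))); last first.
  by rewrite divr_gt0// mulr_gt0.
move=> /le_trans; apply; rewrite le_eqVlt; apply/orP; left; apply/eqP.
by field; rewrite !gt_eqF.
Qed.

(** Enough doublings take one unit of time.  Hence [drift_H] is unbounded, and
    its inverse grows at most by the factor [C] per unit of time. *)
Lemma drift_H_dilation : exists2 C : R, 1 <= C &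
  forall a, w0 <= a -> H a + 1 <= H (C * a).
Proof.
set del := w0 / (2 * phi w0).
have del0 : 0 < del by rewrite divr_gt0// mulr_gt0// phi_gt0.
have pow2 k a : w0 <= a -> H a + k%:R * del <= H (2 ^+ k * a).
  move=> w0a; elim: k => [|k IH]; first by rewrite expr0 mul1r mul0r addr0.
  have w0ka : w0 <= 2 ^+ k * a.
    have a0 : 0 <= a by rewrite ltW// (lt_le_trans w0_gt0).
    by rewrite (le_trans w0a)// ler_peMl// exprn_ege1// ler1n.
  rewrite exprS -mulrA; apply: le_trans (drift_H_double w0ka).
  by rewrite -addn1 natrD mulrDl mul1r addrA lerD2r.
pose k := (Num.truncn del^-1).+1.
exists (2 ^+ k); first by rewrite exprn_ege1// ler1n.
move=> a w0a; apply: le_trans (pow2 k a w0a); rewrite lerD2l.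
by rewrite -ler_pdivrMr// mul1r ltW// truncnS_gt.
Qed.

Lemma drift_H_surj (t : R) : 0 <= t -> exists2 w, w0 <= w & H w = t.
Proof.
move=> t0; have [C C1 HC] := drift_H_dilation.
have w0n n : w0 <= C ^+ n * w0 by rewrite ler_peMl ?exprn_ege1 ?(ltW w0_gt0).
have Hn n : n%:R <= H (C ^+ n * w0).
  elim: n => [|n IH]; first by rewrite expr0 mul1r drift_H_w0.
  by rewrite exprS -mulrA -natr1 (le_trans _ (HC _ (w0n n)))// lerD2r.
pose b := C ^+ (Num.truncn t).+1 * w0.
have w0b : w0 <= b by exact: w0n.
have Hb : t <= H b by rewrite (le_trans _ (Hn _))// ltW// truncnS_gt.
have cH := parameterized_integral_continuous w0b (integrable_inv_concave b).
have [|w] := IVT (v := t) w0b cH.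
  rewrite ge_min le_max; change (((H w0 <= t) || (H b <= t)) &&
    ((t <= H w0) || (t <= H b))).
  by rewrite Hb orbT andbT drift_H_w0 t0.
by rewrite in_itv/= => /andP[w0w _] <-; exists w.
Qed.

Let drift_H_set_surj : set_surj `[w0, +oo[%classic [set t | 0 <= t] H.
Proof.
move=> t /= /drift_H_surj[w w0w Hw]; exists w => //=.
by rewrite in_itv/= w0w.
Qed.

Lemma drift_HinvK (t : R) : 0 <= t -> H (drift_Hinv w0 phi t) = t.
Proof. by move=> t0; apply: (surjpK _ drift_H_set_surj); rewrite inE. Qed.

Lemma drift_Hinv_ge (t : R) : 0 <= t -> w0 <= drift_Hinv w0 phi t.
Proof.
move=> t0; have : `[w0, +oo[%classic (drift_Hinv w0 phi t).
  by apply: (surjpinv_image_sub drift_H_set_surj); exists t.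
by rewrite /= in_itv/= andbT.
Qed.

End drift_comparison.

(** * Moments of the adaptive process *)

Lemma probability_integral_cst d (T : measurableType d) (R : realType)
    (mu : probability T R) (c : R) : (\int[mu]__ c%:E = c%:E)%E.
Proof.
rewrite integral_cst// -[RHS]mule1; congr (_ * _)%E.
exact: probability_setT.
Qed.

Section mixture_integral.
Context d1 d2 (T : measurableType d1) (U : measurableType d2) (R : realType).
Context (mu : probability T R) (k : R.-pker T ~> U).
Local Open Scope ereal_scope.

(** A mixture is the composition of two kernels, the first of which is
    constant on a one-point space. *)
Lemma ge0_integral_mixture (f : U -> \bar R) :
  (forall u, 0 <= f u) -> measurable_fun [set: U] f ->
  \int[mixture mu k]_u f u = \int[mu]_x \int[k x]_u f u.
Proof.
move=> f0 mf.
pose l : R.-pker unit ~> T :=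
  kprobability (@measurable_cst _ _ unit _ [set: unit] (mu : pprobability T R)).
by rewrite -(@integral_kcomp _ _ _ _ _ _ _ l (kernel.kernel_snd k) tt f).
Qed.

End mixture_integral.

Section adaptive_moments.
Context {R : realType} {X : polishMetricType R}
  {dY : measure_display} {Y : measurableType dY}.
Context (P : R.-pker (borel X * Y) ~> borel X).
Local Open Scope ereal_scope.

Lemma last_state_extend t (h : t.+1.-tuple (Y * borel X)%type) z :
  last_state (extend h z) = z.2.
Proof.
by rewrite /last_state (tnth_nth z) /= nth_rcons size_tuple ltnn eqxx.
Qed.

Lemma ge0_integral_adaptive_step t
    (Q : R.-pker t.+1.-tuple (Y * borel X)%type ~> Y) h
    (f : borel X -> \bar R) :
  (forall x, 0 <= f x) -> measurable_fun [set: borel X] f ->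
  \int[adaptive_step P Q h]_h' f (last_state h') =
  \int[Q h]_g \int[P (last_state h, g)]_x f x.
Proof.
move=> f0 mf.
have mfl : measurable_fun setT (f \o @last_state R X dY Y t.+1).
  exact: measurableT_comp (@measurable_last_state _ _ _ _ _).
rewrite (integral_kcomp _ _ _ (f := f \o @last_state R X dY Y t.+1))//;
  last by move=> z; exact: f0.
apply: eq_integral => g _.
rewrite (integral_kcomp _ _ _ (f := f \o @last_state R X dY Y t.+1))//;
  last by move=> z; exact: f0.
apply: eq_integral => x _.
by rewrite integral_dirac// diracT mul1e /= last_state_extend.
Qed.

Lemma ge0_integral_adaptive_marginal (Q : adaptation_plan X Y) init t
    (f : borel X -> \bar R) :
  (forall x, 0 <= f x) -> measurable_fun [set: borel X] f ->
  \int[adaptive_marginal P Q init t]_x f x =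
  \int[adaptive_law P Q init t]_h f (last_state h).
Proof.
by move=> f0 mf; rewrite ge0_integral_pushforward.
Qed.

(** This is Jensen's inequality for [phi]: replacing [phi] by its tangent line
    at [c] makes the drift bound affine in [V], so its mean depends on the
    mean of [V] alone. *)
Lemma adaptive_moment_step (phi : R -> R) (V : borel X -> R)
    (Q : adaptation_plan X Y) init t (c : R) :
  (forall v : R, 0 < v -> 0 < phi v)%R -> concave_on `]0%R, +oo[ phi ->
  (forall x, 0 < V x)%R -> measurable_fun [set: borel X] V ->
  (forall x g, \int[P (x, g)]_y (V y)%:E <= (V x + phi (V x))%:E) ->
  (0 < c)%R ->
  \int[adaptive_marginal P Q init t]_x (V x)%:E <= c%:E ->
  \int[adaptive_marginal P Q init t.+1]_x (V x)%:E <= (c + phi c)%:E.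
Proof.
move=> phi0 cphi V0 mV drift c0 Vc.
have mVE : measurable_fun [set: borel X] (EFin \o V) by exact/measurable_EFinP.
have VE0 x : 0 <= (V x)%:E by rewrite lee_fin ltW.
have mlast n := @measurable_last_state R X dY Y n.
have mVl n : measurable_fun setT (EFin \o V \o @last_state R X dY Y n).
  exact: measurableT_comp.
have [a [s [a0 s0 -> tan]]] := concave_tangent phi0 cphi c0.
rewrite ge0_integral_adaptive_marginal//= in Vc.
rewrite ge0_integral_adaptive_marginal//=.
rewrite (ge0_integral_mixture _ _
    (f := EFin \o V \o @last_state R X dY Y t.+1))//;
  [|by move=> h; exact: VE0|exact: mVl].
have step h : \int[adaptive_step P (Q t) h]_h' (V (last_state h'))%:E <=
    a%:E + (1 + s)%:E * (V (last_state h))%:E.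
  rewrite (ge0_integral_adaptive_step _ _ (f := EFin \o V))//.
  apply: (@le_trans _ _ (\int[Q t h]_g
      (a%:E + (1 + s)%:E * (V (last_state h))%:E))).
    apply: ge0_le_integral => //.
    - by move=> g _; apply: integral_ge0 => ? _; exact: VE0.
    - apply: measurable_fun_integral_kernel => // U mU.
      apply: (measurableT_comp (measurable_kernel P U mU)).
      exact: measurable_fun_pair.
    - move=> g _; apply: (le_trans (drift _ _)).
      rewrite -EFinM -EFinD lee_fin.
      by have := tan _ (V0 (last_state h)); lra.
  by rewrite integral_cst// prob_kernel mule1.
apply: (@le_trans _ _ (\int[adaptive_law P Q init t]_h
    (a%:E + (1 + s)%:E * (V (last_state h))%:E))).
  apply: ge0_le_integral => //.
  - by move=> h _; apply: integral_ge0 => ? _; exact: VE0.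
  - apply: measurable_fun_integral_kernel => [U mU|h|].
    + exact: measurable_kernel.
    + exact: VE0.
    + exact: mVl.
  - apply: emeasurable_funD => //; apply: measurable_funeM.
    exact: mVl.
  - by move=> h _; exact: step.
have s10 : (0 <= 1 + s)%R by lra.
rewrite ge0_integralD//; last 2 first.
- by move=> h _; rewrite mule_ge0// lee_fin.
- by apply: measurable_funeM; exact: mVl.
rewrite probability_integral_cst ge0_integralZl_EFin//; last exact: mVl.
apply: (@le_trans _ _ (a%:E + (1 + s)%:E * c%:E)).
  by rewrite leeD2l// lee_pmul2l ?lte_fin//; lra.
by rewrite -EFinM -EFinD lee_fin; lra.
Qed.

(** The bounds [e] given by iterating the drift inequality advance
    [drift_H] by at most one per step, uniformly in the adaptation plan. *)
Lemma adaptive_moment_le (phi : R -> R) (V : borel X -> R)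
    (Q : adaptation_plan X Y) gamma0 x0 t :
  (forall v : R, 0 < v -> 0 < phi v)%R -> concave_on `]0%R, +oo[ phi ->
  (forall x, 0 < V x)%R -> measurable_fun [set: borel X] V ->
  (forall x g, \int[P (x, g)]_y (V y)%:E <= (V x + phi (V x))%:E) ->
  \int[adaptive_marginal P Q (gamma0, x0) t]_x (V x)%:E <=
  (drift_Hinv (V x0) phi t%:R)%:E.
Proof.
move=> phi0 cphi V0 mV drift.
have Vx0 := V0 x0.
pose e n := iter n (fun v => v + phi v)%R (V x0).
have e_ge n : (V x0 <= e n)%R.
  elim: n => [|n IH]; first exact: lexx.
  by rewrite (le_trans IH)// lerDl ltW// phi0// (lt_le_trans Vx0).
have He n : (drift_H (V x0) phi (e n) <= n%:R)%R.
  elim: n => [|n IH]; first by rewrite /e/= drift_H_w0.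
  rewrite -natr1 (le_trans (drift_H_step phi0 cphi Vx0 (e_ge n)))//.
  by rewrite lerD2r.
apply: (@le_trans _ _ (e t)%:E); last first.
  rewrite lee_fin; apply: (drift_H_le_inv phi0 cphi Vx0).
    exact: drift_Hinv_ge.
  by rewrite drift_HinvK.
elim: t => [|t IH]; last first.
  by apply: adaptive_moment_step => //; rewrite (lt_le_trans Vx0).
have mVE : measurable_fun [set: borel X] (EFin \o V) by exact/measurable_EFinP.
rewrite ge0_integral_adaptive_marginal//=; last first.
  by move=> x; rewrite lee_fin ltW.
rewrite integral_dirac//; last first.
  exact: (measurableT_comp mVE (@measurable_last_state _ _ _ _ _)).
by rewrite diracT mul1e /last_state (tnth_nth (gamma0, x0)).
Qed.

End adaptive_moments.

(** * Tails of a random variable with infinite mean *)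

Section heavy_tail.
Context d (T : measurableType d) (R : realType) (mu : probability T R).
Context (W : T -> R) (mW : measurable_fun [set: T] W).

Let dyadic_layer (x : T) k0 : 2 ^+ k0 <= W x ->
  exists j, 2 ^+ (k0 + j) <= W x < 2 ^+ (k0 + j).+1.
Proof.
move=> Wx; have exP : exists n, W x < 2 ^+ (k0 + n).
  exists (Num.truncn (W x)).+1; rewrite exprD.
  rewrite (lt_le_trans (truncnS_gt (W x)))//.
  apply: (@le_trans _ _ (2 ^+ (Num.truncn (W x)).+1)).
    by rewrite -natrX ler_nat ltnW// ltn_expl.
  by rewrite ler_peMl// exprn_ege1// ler1n.
case: (ex_minnP exP) => -[|j]; first by rewrite addn0 ltNge Wx.
rewrite addnS => Wj jmin; exists j; rewrite Wj andbT leNgt.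
by apply/negP => /jmin; rewrite ltnn.
Qed.

(** The layers between consecutive powers of 2 bound the mean of [W] by
    [2 ^+ k0] plus the sum of [2 ^+ k.+1] times the probability that [W]
    exceeds [2 ^+ k].  If each probability were smaller than stated, this
    would be a convergent geometric series of ratio [2 `^ (- beta)]. *)
Lemma heavy_tail (beta : R) (k0 : nat) : 0 < beta ->
  (forall x, 0 <= W x) -> (\int[mu]_x (W x)%:E = +oo)%E ->
  exists2 k, (k0 <= k)%N &
    (((2 ^+ k) `^ (- (1 + beta)))%:E <= mu [set x | (2 ^+ k <= W x)%R])%E.
Proof.
move=> beta0 W0 intW; apply: contrapT => no_k.
pose A k := [set x | 2 ^+ k <= W x].
have mA k : measurable (A k).
  have -> : A k = W @^-1` `[2 ^+ k, +oo[.
    by apply/seteqP; split => x; rewrite /A/= in_itv/= andbT.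
  by rewrite -[X in measurable X]setTI; exact: mW.
pose q : R := 2 `^ (- beta).
have q0 : 0 < q by rewrite powR_gt0.
have q1 : q < 1.
  rewrite /q powRN invf_lt1 ?powR_gt0//.
  have := @gt0_ltr_powR R beta beta0 1 2.
  by rewrite !nnegrE powR1 => -> //; rewrite ltr1n.
have pow2 k : (2 ^+ k) `^ (- (1 + beta)) = (2 ^+ k)^-1 * q ^+ k.
  rewrite opprD powRD; last by apply/implyP => _; rewrite expf_neq0.
  rewrite powRN powRr1 ?exprn_ge0//; congr (_ * _).
  by rewrite -!powR_mulrn ?powR_ge0// -!powRrM mulrC.
have muA j : (mu (A (k0 + j)%N) <= ((2 ^+ (k0 + j))^-1 * q ^+ j)%:E)%E.
  rewrite leNgt; apply/negP => muAj; apply: no_k.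
  exists (k0 + j)%N; first exact: leq_addr.
  apply: le_trans (ltW muAj); rewrite lee_fin pow2.
  rewrite ler_wpM2l ?invr_ge0 ?exprn_ge0//.
  by rewrite exprD ler_piMl ?exprn_ile1 ?exprn_ge0 ?(ltW q0) ?(ltW q1).
pose g j x : \bar R := ((2 ^+ (k0 + j).+1) * \1_(A (k0 + j)%N) x)%:E.
have g0 j x : (0 <= g j x)%E by rewrite lee_fin mulr_ge0 ?exprn_ge0.
have mg j : measurable_fun [set: T] (g j).
  by apply/measurable_EFinP; apply: measurable_funM.
have Wg x : ((W x)%:E <= (2 ^+ k0)%:E + \sum_(j <oo) g j x)%E.
  have [Wx|/dyadic_layer[j /andP[Wj Wj1]]] := ltP (W x) (2 ^+ k0).
    rewrite -[leLHS]adde0 leeD ?lee_fin ?(ltW Wx)//.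
    apply: nneseries_ge0 => j _ _; exact: g0.
  rewrite -[leLHS]add0e leeD// ?lee_fin ?exprn_ge0//.
  apply: le_trans (nneseries_lim_ge j.+1 _); last by move=> i _ _; exact: g0.
  rewrite big_nat_recr//= -[leLHS]add0e leeD ?sume_ge0// lee_fin.
  by rewrite indicE mem_set// mulr1 ltW.
have int_g j : (\int[mu]_x g j x <= (geometric 2 q j)%:E)%E.
  rewrite /g; under eq_integral do rewrite EFinM.
  rewrite ge0_integralZl_EFin//; last first.
    by apply/measurable_EFinP; exact: measurable_indic.
  rewrite integral_indic// setIT.
  apply: (@le_trans _ _ ((2 ^+ (k0 + j).+1)%:E *
      ((2 ^+ (k0 + j))^-1 * q ^+ j)%:E)%E).
    by apply: lee_wpmul2l (muA j); rewrite lee_fin exprn_ge0.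
  by rewrite -EFinM lee_fin exprS mulrA mulfK// expf_neq0.
have : (\int[mu]_x (W x)%:E <= (2 ^+ k0 + 2 / (1 - q))%:E)%E.
  apply: (@le_trans _ _ (\int[mu]_x ((2 ^+ k0)%:E + \sum_(j <oo) g j x))%E).
    apply: ge0_le_integral => //.
    - by move=> x _; rewrite lee_fin.
    - exact/measurable_EFinP.
    - apply: emeasurable_funD => //.
      by apply: ge0_emeasurable_sum => // j x _ _; exact: g0.
  rewrite ge0_integralD//; last 2 first.
  - by move=> x _; apply: nneseries_ge0 => j _ _; exact: g0.
  - by apply: ge0_emeasurable_sum => // j x _ _; exact: g0.
  rewrite probability_integral_cst EFinD leeD2l//.
  rewrite integral_nneseries//.
  apply: lime_le.
    by apply: is_cvg_nneseries => j _ _; exact: integral_ge0.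
  apply: nearW => n.
  apply: (@le_trans _ _ (\sum_(0 <= j < n) (geometric 2 q j)%:E)%E).
    by apply: lee_sum => j _.
  rewrite sumEFin lee_fin; apply: geometric_le_lim => //.
  by rewrite ger0_norm// ltW.
by rewrite intW leye_eq.
Qed.

End heavy_tail.

(** * Lower bounds for the Wasserstein distance by test functions *)

(** The integral of a nonnegative function is a supremum over the simple
    functions below it, so it is monotone even among functions that are not
    known to be measurable.  The larger function will be the capped distance
    on the product of two copies of the space. *)
Lemma ge0_le_integralT d (T : measurableType d) (R : realType)
    (mu : {measure set T -> \bar R}) (f g : T -> \bar R) :
  (forall x, 0 <= f x)%E -> (forall x, f x <= g x)%E ->
  (\int[mu]_x f x <= \int[mu]_x g x)%E.
Proof.
move=> f0 fg; have g0 x : (0 <= g x)%E := le_trans (f0 x) (fg x).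
rewrite !ge0_integralTE//; apply: le_ereal_sup => _ [h hf <-].
by exists h => // x; exact: le_trans (hf x) (fg x).
Qed.

Section lipschitz.
Context {R : realType} {X : polishMetricType R}.

Lemma metric_lipschitz_measurable (u : X -> R) :
  metric_lipschitz u -> measurable_fun [set: borel X] (u : borel X -> R).
Proof.
move=> [L uL]; pose K := Num.max 1 L.
have K0 : 0 < K by rewrite lt_max ltr01.
have cu : continuous (u : X -> R^o).
  move=> x; apply/cvgrPdist_lt => e e0; apply/nbhs_ballP.
  exists (e / K); first by rewrite /= divr_gt0.
  move=> y; rewrite ballEmdist /= ltr_pdivlMr// mulrC; apply: le_lt_trans.
  by rewrite (le_trans (uL x y))// ler_wpM2r ?mdist_ge0// le_max lexx orbT.
apply: (measurability _ (RGenOpens.measurableE R)) => _ [_ [a [b ->]] <-].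
rewrite setTI; apply: sub_sigma_algebra.
by move/continuousP : cu; apply; exact: interval_open.
Qed.

(** The easy half of Kantorovich duality: under any coupling, the mean of
    [g z.2 - g z.1] is the difference of the two means of [g], and it is at
    most [K] times the transport cost. *)
Lemma wasserstein_min1_ge (mu nu : probability (borel X) R) (g : borel X -> R)
    (K p m : R) :
  0 < K -> (forall x, 0 <= g x) -> measurable_fun [set: borel X] g ->
  (forall x y : X, g y - g x <= K * Num.min (mdist x y) 1) ->
  (p%:E <= \int[nu]_x (g x)%:E)%E -> (\int[mu]_x (g x)%:E <= m%:E)%E ->
  (((p - m) / K)%:E <= wasserstein_min1 mu nu)%E.
Proof.
move=> K0 g0 mg gK pnu mum; apply: le_ereal_inf_tmp => _ [xi xiC <-].
have mgE : measurable_fun [set: borel X] (EFin \o g) by exact/measurable_EFinP.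
have mg1 : measurable_fun [set: borel X * borel X] (fun z => g z.1).
  exact: measurableT_comp.
have mg2 : measurable_fun [set: borel X * borel X] (fun z => g z.2).
  exact: measurableT_comp.
have int1 : (\int[mu]_x (g x)%:E = \int[xi]_z (g z.1)%:E)%E.
  rewrite -(@ge0_integral_pushforward _ _ _ _ _ _ measurable_fst xi setT
    (EFin \o g))//; last by move=> x _; rewrite lee_fin.
  by apply: eq_measure_integral => A mA _; exact/esym/(xiC A mA).1.
have int2 : (\int[nu]_x (g x)%:E = \int[xi]_z (g z.2)%:E)%E.
  rewrite -(@ge0_integral_pushforward _ _ _ _ _ _ measurable_snd xi setT
    (EFin \o g))//; last by move=> x _; rewrite lee_fin.
  by apply: eq_measure_integral => A mA _; exact/esym/(xiC A mA).2.
(* the positive part of the increment is measurable, unlike a priori the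
   transport cost that dominates it *)
pose h (z : borel X * borel X) : R := Num.max 0 ((g z.2 - g z.1) / K).
have h0 z : 0 <= h z by rewrite le_max lexx.
have mh : measurable_fun setT h.
  apply: measurable_maxr => //; apply: measurable_funM => //.
  exact: measurable_funB.
have hc : (\int[xi]_z (h z)%:E <=
    \int[xi]_z (Num.min (mdist (z.1 : X) (z.2 : X)) 1)%:E)%E.
  apply: ge0_le_integralT => z; rewrite lee_fin//.
  rewrite ge_max le_min mdist_ge0 ler01/=.
  by rewrite ler_pdivrMr// mulrC gK.
apply: le_trans hc.
have : (p%:E <= m%:E + K%:E * \int[xi]_z (h z)%:E)%E.
  apply: (le_trans pnu).
  apply: (@le_trans _ _ (\int[xi]_z ((g z.1)%:E + K%:E * (h z)%:E))%E).
    rewrite int2; apply: ge0_le_integralT => z; first by rewrite lee_fin.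
    rewrite -EFinM -EFinD lee_fin /h maxr_pMr ?(ltW K0)// mulr0.
    rewrite mulrC divfK ?gt_eqF//.
    by rewrite -lerBlDl le_max lexx orbT.
  rewrite ge0_integralD//; last 4 first.
  - by move=> z _; rewrite lee_fin.
  - exact/measurable_EFinP.
  - by move=> z _; rewrite -EFinM lee_fin mulr_ge0// ltW.
  - by apply: measurable_funeM; exact/measurable_EFinP.
  rewrite -int1 ge0_integralZl_EFin ?(ltW K0)//; first by rewrite leeD2r.
  - by move=> z _; rewrite lee_fin.
  - exact/measurable_EFinP.
have : (0 <= \int[xi]_z (h z)%:E)%E.
  by apply: integral_ge0 => z _; rewrite lee_fin.
case: (\int[xi]_z (h z)%:E)%E => [r _| |//]; last by move=> _ _; rewrite leey.
by rewrite -EFinM -EFinD !lee_fin ler_pdivrMr// => ?; lra.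
Qed.

End lipschitz.

(** * Comparison of the tails *)

Section ramp.
Context {R : realType}.

Definition ramp (v : R) : R := Num.max 0 (Num.min 1 v).

Lemma ramp_ge0 v : 0 <= ramp v.
Proof. by rewrite le_max lexx. Qed.

Lemma ramp_le1 v : ramp v <= 1.
Proof. by rewrite ge_max ler01 ge_min lexx. Qed.

Lemma ramp_eq1 v : 1 <= v -> ramp v = 1.
Proof. by move=> v1; rewrite /ramp min_l// max_r. Qed.

Lemma rampB_le v w : ramp w - ramp v <= `|v - w|.
Proof.
have := ler_norm (v - w); have := ler_norm (w - v); rewrite distrC.
set d := `|v - w| => h1 h2; have d0 : 0 <= d by exact: normr_ge0.
rewrite lerBlDr /ramp ge_max addr_ge0 ?le_max ?lexx//= ge_min.
have [v1|v1] := leP 1 v.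
  by rewrite (max_r ler01) lerDr d0.
by apply/orP; right; have [v0|v0] := leP 0 v; lra.
Qed.

End ramp.

Section lower_bound.
Context {R : realType} {X : polishMetricType R}.
Context (W : X -> R) (W_ge1 : forall x, 1 <= W x).
Context (lnW_lipschitz : metric_lipschitz (fun x => ln (W x))).

Let W_gt0 x : 0 < W x := lt_le_trans ltr01 (W_ge1 x).

Lemma measurable_lnW :
  measurable_fun [set: borel X] (fun x : borel X => ln (W x)).
Proof. exact: metric_lipschitz_measurable. Qed.

Lemma measurable_W : measurable_fun [set: borel X] (W : borel X -> R).
Proof.
rewrite (_ : W = fun x => expR (ln (W x))); last first.
  by apply/funext => x; rewrite lnK// posrE.
exact: (measurableT_comp (@measurable_expR R) measurable_lnW).
Qed.

Lemma measurable_W_powR (alpha : R) :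
  measurable_fun [set: borel X] (fun x : borel X => W x `^ alpha).
Proof. exact: (measurableT_comp (@measurable_powR R alpha) measurable_W). Qed.

(** The test function is a ramp in [ln W] of width 1 ending at [ln r].  It
    dominates the indicator of [W >= r], and it is dominated by
    [(expR 1 * W / r) `^ alpha], because it is at most 1 and vanishes where
    that power is less than 1; the latter is Markov's inequality. *)
Lemma wasserstein_min1_tail_ge : exists2 K : R, 0 < K &
  forall (mu nu : probability (borel X) R) (alpha r c h : R),
  0 <= alpha -> 0 < r ->
  (\int[mu]_x (W x `^ alpha)%:E <= h%:E)%E ->
  (c%:E <= nu [set x | (r <= W x)%R])%E ->
  (((c - (expR 1 / r) `^ alpha * h) / K)%:E <= wasserstein_min1 mu nu)%E.
Proof.
have [L uL] := lnW_lipschitz.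
exists (Num.max 1 L); first by rewrite lt_max ltr01.
move=> mu nu alpha r c h alpha0 r0 muW nuW.
pose g (x : borel X) : R := ramp (ln (W x) - ln r + 1).
have mg : measurable_fun [set: borel X] g.
  apply: measurable_maxr => //; apply: measurable_minr => //.
  apply: measurable_funD => //; apply: measurable_funB => //.
  exact: measurable_lnW.
have K0 : 0 < Num.max 1 L by rewrite lt_max ltr01.
have er0 : 0 < expR 1 / r by rewrite divr_gt0 ?expR_gt0.
apply: (wasserstein_min1_ge (g := g)) => //.
- by move=> x; exact: ramp_ge0.
- move=> x y; rewrite /Num.min; case: ifPn => _.
    apply: le_trans (rampB_le _ _) _.
    rewrite (_ : _ - _ = ln (W x) - ln (W y)); last by lra.
    by rewrite (le_trans (uL x y))// ler_wpM2r ?mdist_ge0// le_max lexx orbT.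
  have := ramp_le1 (ln (W y) - ln r + 1).
  have := ramp_ge0 (ln (W x) - ln r + 1).
  have : 1 <= Num.max 1 L by rewrite le_max lexx.
  rewrite /g; lra.
- apply: (le_trans nuW).
  have mA : measurable [set x : borel X | r <= W x].
    have -> : [set x : borel X | r <= W x] = W @^-1` `[r, +oo[.
      by apply/seteqP; split => x; rewrite /= in_itv/= andbT.
    by rewrite -[X in measurable X]setTI; exact: measurable_W.
  rewrite -[X in nu X]setIT -integral_indic//.
  apply: ge0_le_integralT => x; rewrite lee_fin// indicE.
  have [|_] := boolP (x \in _); last exact: ramp_ge0.
  rewrite inE/= => rW; rewrite /g ramp_eq1// lerDr subr_ge0.
  by rewrite ler_ln ?posrE.
- apply: (@le_trans _ _ (\int[mu]_x (((expR 1 / r) `^ alpha)%:E *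
      (W x `^ alpha)%:E))%E).
    apply: ge0_le_integralT => x; first by rewrite lee_fin ramp_ge0.
    rewrite -EFinM lee_fin -powRM ?(ltW er0) ?(ltW (W_gt0 x))//.
    have [small|big] := leP (ln (W x) - ln r + 1) 0.
      have -> : g x = 0; last exact: powR_ge0.
      by rewrite /g /ramp min_r ?max_l// (le_trans small).
    apply: (le_trans (ramp_le1 _)); rewrite -[leLHS](powRr0 (expR 1 / r * W x)).
    apply: ler_powR => //.
    rewrite -ler_ln ?posrE ?mulr_gt0 ?invr_gt0 ?expR_gt0//.
    rewrite ln1 lnM ?posrE// lnM ?posrE ?invr_gt0 ?expR_gt0//.
    by rewrite expRK lnV ?posrE//; lra.
  rewrite ge0_integralZl_EFin ?powR_ge0//; last 2 first.
  + by move=> x _; rewrite lee_fin powR_ge0.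
  + by apply/measurable_EFinP; exact: measurable_W_powR.
  rewrite EFinM; apply: lee_wpmul2l muW.
  by rewrite lee_fin powR_ge0.
Qed.

End lower_bound.

(** * Selection of the times *)

Lemma strictly_increasing_choice (G : nat -> Prop) :
  (forall N, exists2 t, (N <= t)%N & G t) ->
  exists t : nat -> nat, [/\ forall n, (0 < t n)%N,
    forall n, (t n < t n.+1)%N & forall n, G (t n)].
Proof.
move=> exG; have [|f fP] := @boolp.choice _ _ (fun N t => (N <= t)%N /\ G t).
  by move=> N; have [t Nt Gt] := exG N; exists t.
pose t := fix t n := if n is n'.+1 then f (t n').+1 else f 1.
exists t; split => [n|n|[|n]] /=; try exact: (fP _).2.
  by case: n => [|n] /=; [exact: (fP 1).1|exact: leq_ltn_trans (fP _).1].
exact: (fP (t n).+1).1.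
Qed.

Section adaptive_lower_bound.
Context {R : realType} {X : polishMetricType R}
  {dY : measure_display} {Y : measurableType dY}.
Context (P : R.-pker (borel X * Y) ~> borel X) (pi : probability (borel X) R).
Context (gamma0 : Y) (x0 : X) (W : X -> R) (alpha : R) (phi : R -> R).
Context (W_ge1 : forall x, 1 <= W x).
Context (lnW_lipschitz : metric_lipschitz (fun x => ln (W x))).
Context (W_integral : (\int[pi]_x (W x)%:E = +oo)%E).
Context (phi_gt0 : forall v, 0 < v -> 0 < phi v).
Context (phi_concave : concave_on `]0, +oo[ phi).
Context (drift : forall (x : X) (gamma : Y),
  (\int[P (x, gamma)]_y (W y `^ alpha)%:E - (W x `^ alpha)%:E
     <= (phi (W x `^ alpha))%:E)%E).
Context (beta : R) (beta_gt0 : 0 < beta) (beta_lt : 1 + beta < alpha).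

Local Notation w0 := (W x0 `^ alpha).
Local Notation h := (drift_Hinv w0 phi).
Local Notation p := ((1 + beta) / (alpha - 1 - beta)).

(** For a large [r] in the heavy tail of [pi], the time [t] is the last one
    with [h t <= V], where [V] is the threshold at which the bound
    [(expR 1 / r) `^ alpha * V] for the process equals half of
    [r `^ (- (1 + beta))]. *)
Lemma adaptive_lower_bound_frequently : exists2 M : R, 0 < M &
  forall N : nat, exists2 t, (N <= t)%N &
  forall Q : adaptation_plan X Y,
  ((M / h t%:R `^ p)%:E <=
     wasserstein_min1 (adaptive_marginal P Q (gamma0, x0) t) pi)%E.
Proof.
have W_gt0 x : 0 < W x := lt_le_trans ltr01 (W_ge1 x).
have V_gt0 x : 0 < W x `^ alpha by rewrite powR_gt0.
have w0_gt0 := V_gt0 x0.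
have [b0 ab] : 0 < beta /\ 1 + beta < alpha by [].
have alpha0 : 0 <= alpha by lra.
have s0 : 0 < alpha - 1 - beta by lra.
have p0 : 0 < p by rewrite divr_gt0//; lra.
have [K K0 KP] := wasserstein_min1_tail_ge W_ge1 lnW_lipschitz.
have [C C1 CP] := drift_H_dilation phi_gt0 phi_concave w0_gt0.
have hK t : drift_H w0 phi (h t%:R) = t%:R by exact: drift_HinvK.
have h_ge t : w0 <= h t%:R by exact: drift_Hinv_ge.
have h_gt0 t : 0 < h t%:R by exact: lt_le_trans (h_ge t).
pose B := 2 * expR 1 `^ alpha.
have E0 : 0 < expR (1 : R) `^ alpha by rewrite powR_gt0 ?expR_gt0.
have B0 : 0 < B by rewrite mulr_gt0.
have C0 : 0 < C by lra.
pose D := (B * C) `^ p.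
have D0 : 0 < D by rewrite powR_gt0 ?mulr_gt0.
exists (2 * K * D)^-1; first by rewrite invr_gt0 !mulr_gt0.
move=> N.
(* from this level on, the threshold V exceeds h N, which makes t at least N *)
pose k0 := (Num.truncn ((B * h N%:R) `^ (alpha - 1 - beta)^-1)).+1.
have [k k0k tail] := heavy_tail (measurable_W W_ge1 lnW_lipschitz) k0 beta_gt0
  (fun x => ltW (W_gt0 x)) W_integral.
set r : R := 2 ^+ k in tail.
have r0 : 0 < r by rewrite exprn_gt0.
pose S := r `^ (alpha - 1 - beta).
have S0 : 0 < S by rewrite powR_gt0.
have hN_S : B * h N%:R <= S.
  rewrite (_ : B * _ = ((B * h N%:R) `^ (alpha - 1 - beta)^-1)
      `^ (alpha - 1 - beta)); last first.
    rewrite -powRrM mulVf ?gt_eqF// powRr1//.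
    by rewrite mulr_ge0 ?(ltW B0) ?(ltW (h_gt0 N)).
  apply: ge0_ler_powR; rewrite ?nnegrE ?powR_ge0 ?(ltW s0) ?(ltW r0)//.
  apply: (@le_trans _ _ k0%:R); first by rewrite ltW// truncnS_gt.
  by rewrite /r -natrX ler_nat (leq_trans k0k)// ltnW// ltn_expl.
pose V := S / B.
have hN_V : h N%:R <= V by rewrite ler_pdivlMr// mulrC.
have w0_V : w0 <= V := le_trans (h_ge N) hN_V.
pose t := Num.truncn (drift_H w0 phi V).
have HV_ge : N%:R <= drift_H w0 phi V.
  by rewrite -(hK N); exact: drift_H_le.
have HV0 : 0 <= drift_H w0 phi V by exact: le_trans HV_ge.
have /andP[tV Vt] := truncn_itv HV0.
exists t => [|Q]; first by rewrite truncn_ge_nat.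
have ht_V : h t%:R <= V.
  by apply: (drift_H_le_inv phi_gt0 phi_concave w0_gt0) => //; rewrite hK.
have V_ht : V <= C * h t%:R.
  apply: (drift_H_le_inv phi_gt0 phi_concave w0_gt0).
    by rewrite (le_trans (h_ge t))// ler_peMl// ltW.
  by have := CP _ (h_ge t); rewrite hK natr1; exact: le_trans (ltW Vt).
have moment : (\int[adaptive_marginal P Q (gamma0, x0) t]_x (W x `^ alpha)%:E
    <= (h t%:R)%:E)%E.
  apply: (adaptive_moment_le (V := fun x : borel X => W x `^ alpha)) => //.
    exact: measurable_W_powR.
  by move=> x g; rewrite EFinD addeC -leeBlDr.
apply: le_trans (KP _ _ _ _ _ _ alpha0 r0 moment tail).
rewrite lee_fin -invfM -[leLHS]mul1r ler_pdivrMr; last first.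
  by rewrite !mulr_gt0// powR_gt0.
have r_S : r `^ (1 + beta) <= D * h t%:R `^ p.
  have -> : r `^ (1 + beta) = S `^ p.
    by rewrite -powRrM; congr (_ `^ _); field; rewrite gt_eqF.
  rewrite /D -powRM ?(ltW (h_gt0 t)) ?mulr_ge0 ?(ltW B0) ?(ltW C0)//.
  apply: ge0_ler_powR; rewrite ?nnegrE ?(ltW p0) ?(ltW S0)//.
    by rewrite !mulr_ge0 ?(ltW B0) ?(ltW C0) ?(ltW (h_gt0 t)).
  by rewrite -mulrA mulrC -ler_pdivrMr.
set G := r `^ (1 + beta) in r_S; have G0 : 0 < G by rewrite powR_gt0.
have moment_half : (expR 1 / r) `^ alpha * h t%:R <= G^-1 / 2.
  apply: (@le_trans _ _ ((expR 1 / r) `^ alpha * V)).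
    by rewrite ler_wpM2l// powR_ge0.
  have SG : S = r `^ alpha * G^-1.
    rewrite -powRN -powRD; last by rewrite (gt_eqF r0) implybT.
    by congr (_ `^ _); lra.
  rewrite powRM ?expR_ge0 ?invr_ge0 ?(ltW r0)// -powR_inv1 ?(ltW r0)//.
  rewrite -powRrM mulN1r powRN /V SG /B le_eqVlt; apply/orP; left; apply/eqP.
  by field; rewrite !gt_eqF// ?powR_gt0.
rewrite powRN -/G -/p.
apply: (@le_trans _ _ (G^-1 / 2 / K * (2 * K * D * h t%:R `^ p))); last first.
  apply: ler_wpM2r; first by rewrite !mulr_ge0 ?powR_ge0 ?(ltW K0)// ltW.
  by rewrite ler_wpM2r ?invr_ge0 ?(ltW K0)//; lra.
have -> : G^-1 / 2 / K * (2 * K * D * h t%:R `^ p) = (D * h t%:R `^ p) / G.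
  by field; rewrite !gt_eqF.
by rewrite ler_pdivlMr// mul1r.
Qed.

End adaptive_lower_bound.

Unset Implicit Arguments.
Set Strict Implicit.

Theorem theorem6 (R : realType) (X : polishMetricType R)
    (dY : measure_display) (Y : measurableType dY)
    (P : R.-pker (borel X * Y) ~> borel X) (pi : probability (borel X) R)
    (gamma0 : Y) (x0 : X)
    (W : X -> R) (alpha : R) (phi : R -> R)
    (W_ge1 : forall x, 1 <= W x)
    (lnW_lipschitz : metric_lipschitz (fun x => ln (W x)))
    (W_integral : (\int[pi]_x (W x)%:E = +oo)%E)
    (alpha_gt1 : 1 < alpha)
    (phi_gt0 : forall v, 0 < v -> 0 < phi v)
    (phi_concave : concave_on `]0, +oo[ phi)
    (drift : forall (x : X) (gamma : Y),
       (\int[P (x, gamma)]_y (W y `^ alpha)%:E - (W x `^ alpha)%:E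
          <= (phi (W x `^ alpha))%:E)%E) :
  forall beta : R, 0 < beta -> beta < 1 -> 1 + beta < alpha ->
  exists (M : R) (t : nat -> nat),
    [/\ 0 < M,
        (forall n, (0 < t n)%N),
        (forall n, (t n < t n.+1)%N) &
        (forall n,
           ((M / (drift_Hinv (W x0 `^ alpha) phi (t n)%:R)
                   `^ ((1 + beta) / (alpha - 1 - beta)))%:E
            <= ereal_inf
                 [set wasserstein_min1
                        (adaptive_marginal P Q (gamma0, x0) (t n)) pi
                 | Q in [set: adaptation_plan X Y]])%E)].
Proof.
move=> beta beta0 beta1 beta_alpha.
have [M M0 exM] := adaptive_lower_bound_frequently gamma0 x0 W_ge1 lnW_lipschitz
  W_integral phi_gt0 phi_concave drift beta0 beta_alpha.
have [t [t_gt0 t_lt t_bound]] := strictly_increasing_choice exM.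
exists M, t; split => // n.
by apply: le_ereal_inf_tmp => _ [Q _ <-]; exact: t_bound.
Qed.
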